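(* (Lower bound.) For every real number $\epsilon>0$ there exist infinitely many integers $n\ge 3$ for which $$\ell(n,1)>e^{(1-\epsilon)\sqrt{n\ln n}}.$$ (Upper bound.) For all integers $n\ge 3$ and $k>0$, the integer $\ell(n,k)$ exists and $$\ell(n,k)\le \begin{cases}(2k)^3 & \text{if } n=3,\\[2pt] k^{n-1}2^{-n}(n+1)^{(n+1)/2}\left((k+1)^n-k^n+1\right) & \text{if } n>3.\end{cases}$$
   Context: For an integer $k>0$, a $k$-matrix is a matrix all of whose entries lie in $\{0,1,\ldots,k\}$. A matrix is level if all its column sums are equal. A level matrix with $m$ rows is reducible if one can delete $j$ rows, for some $0<j<m$, so that the remaining matrix is level; otherwise it is irreducible. Rows of a matrix may be repeated. For integers $n>1$ and $k>0$, $\ell(n,k)$ denotes the minimum integer $\ell$ (if it exists) such that for all $m>\ell$ every $m\times n$ level $k$-matrix is reducible; equivalently, $\ell(n,k)$ is the maximum number of rows of an irreducible level $k$-matrix with $n$ columns. *)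

(* Defs.v *)
From HB Require Import structures.
From mathcomp Require Import all_boot all_order all_algebra.
From mathcomp Require Import all_classical all_reals all_analysis.

Set Implicit Arguments.
Unset Strict Implicit.
Unset Printing Implicit Defensive.

Import Order.TTheory GRing.Theory Num.Theory.

Local Open Scope nat_scope.

Definition is_kmatrix (k m n : nat) (A : 'M[nat]_(m, n)) : Prop :=
  forall i j, A i j <= k.

Definition is_level (m n : nat) (A : 'M[nat]_(m, n)) : Prop :=
  forall j1 j2 : 'I_n, \sum_(i < m) A i j1 = \sum_(i < m) A i j2.

Definition delete_rows (m n : nat) (D : {set 'I_m}) (A : 'M[nat]_(m, n)) :
    'M[nat]_(#|~: D|, n) :=
  rowsub (fun i : 'I_#|~: D| => enum_val i) A.

Definition is_reducible (m n : nat) (A : 'M[nat]_(m, n)) : Prop :=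
  exists D : {set 'I_m}, 0 < #|D| < m /\ is_level (delete_rows D A).

Definition reducible_above (n k l : nat) : Prop :=
  forall m : nat, l < m ->
  forall A : 'M[nat]_(m, n), is_kmatrix k A -> is_level A -> is_reducible A.

(* The minimum need not exist a priori, so l(n, k) is given by its graph:     *)
(* [is_ell n k l] means that l(n, k) exists and equals l. Restricting l to    *)
(* nat loses nothing: for k > 0 the all-ones 1 x n matrix is irreducible, so  *)
(* every admissible integer is at least 1.                                    *)
Definition is_ell (n k l : nat) : Prop :=
  reducible_above n k l /\ forall l' : nat, reducible_above n k l' -> l <= l'.

(* Main.v *)
Require Import Defs.
From HB Require Import structures.
From mathcomp Require Import all_classical all_reals all_analysis.
From mathcomp Require Import all_boot all_order all_algebra.
From mathcomp Require Import zify ring lra.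

Set Implicit Arguments.
Unset Strict Implicit.
Unset Printing Implicit Defensive.

Import Order.TTheory GRing.Theory Num.Theory.

(** Deleting rows is keeping a set of rows, so an irreducible level matrix is a
    minimal nonempty multiset of vectors of {0,..,k}^n whose sum is constant.
    Adding a constant to a row does not affect levelness, so rows only matter up
    to constants; the two upper bounds exploit this differently.

    Three columns.  Subtracting the first column turns the rows into vectors of
    Z^2 with entries in [-k, k] and sum zero.  In dimension one, integers of
    absolute value at most B with sum zero always contain a nonempty zero-sum
    set of at most 2B of them, because they can be ordered so that the partial
    sums stay in the 2B values of ]-B, B] ([short_zero_sum]).  Cutting the rows
    into blocks of at most 2k rows whose first coordinates cancel, and applying
    the same fact to the second coordinates of the blocks, which are bounded by
    2k^2, gives a level set of at most 4k^2 blocks, hence of at most (2k)^3 rows.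

    More columns.  Shift every row so that its minimum is 0, and let x count the
    rows of each resulting type.  The level weights on types form a cone.  A
    level weight of minimal support is determined up to scaling by Cramer's
    rule, so some multiple of it is an integer weight, and its total is the
    determinant of a bordered (p+1) x (p+1) matrix, p being the size of the
    support.  Recentring the entries from [0, k] to [-k/2, k/2] does not change
    a determinant with border 1, and Hadamard's inequality bounds it by
    C = (k/2)^(n-1) (n+1)^((n+1)/2) ([small_ray]).  Peeling such integer weights
    off x removes one type at a time, each time with a coefficient below 1,
    since otherwise x would contain a smaller level weight; so the number of
    rows is at most C times the number of types ([irreducible_weight_le]).
    Finally a type u and its antipode max u - u cannot both occur, as a row of
    each would form a level pair, and therefore at most half of the
    (k+1)^n - k^n types with minimum 0 are used ([irreducible_size_le]).

    Lower bound.  Much more than the stated bound holds: there are irreducible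
    0-1 matrices with n = 2N+1 columns and at least 2^N rows
    ([large_irreducible]).  Each column expresses one equation between
    multiplicities, and the equations x_j = 1 + x_0 + .. + x_(j-1) can be
    imposed, which force x_j = 2^j.  As sqrt (n ln n) is o(n), 2^((n-1)/2)
    exceeds exp (sqrt (n ln n)) for large n. *)

Local Open Scope ring_scope.

(** * Reducibility in terms of the rows that are kept *)

Lemma big_setT_ord m (F : 'I_m -> nat) : (\sum_(i in [set: 'I_m]) F i = \sum_i F i)%N.
Proof. by apply: eq_bigl => i; rewrite inE. Qed.

Lemma sum_delete_rows m n (D : {set 'I_m}) (A : 'M[nat]_(m, n)) j :
  (\sum_i delete_rows D A i j = \sum_(i in ~: D) A i j)%N.
Proof. by rewrite [RHS]big_enum_val; apply: eq_bigr => i _; rewrite mxE. Qed.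

Lemma reducibleP m n (A : 'M[nat]_(m, n)) :
  is_reducible A <-> exists E : {set 'I_m}, (0 < #|E| < m)%N /\
    forall j1 j2, (\sum_(i in E) A i j1 = \sum_(i in E) A i j2)%N.
Proof.
split=> [[D [cD lD]]|[E [cE lE]]].
  exists (~: D); split; first by have := cardsC D; rewrite card_ord; lia.
  by move=> j1 j2; rewrite -!sum_delete_rows; apply: lD.
exists (~: E); split; first by have := cardsC E; rewrite card_ord; lia.
by move=> j1 j2; rewrite !sum_delete_rows setCK; apply: lE.
Qed.

Lemma ell_exists n k b : reducible_above n k b -> exists2 l, is_ell n k l & (l <= b)%N.
Proof.
move=> rb; have exP : exists l, `[< reducible_above n k l >] by exists b; apply/asboolP.
case: (ex_minnP exP) => l /asboolP rl minl; exists l.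
  by split => // l' rl'; apply: minl; apply/asboolP.
by apply: minl; apply/asboolP.
Qed.

(** * Short zero-sum sets and three columns *)

(** Greedy choice: while the running sum is positive some unused element is
    negative, since everything adds up to 0; otherwise some unused element is
    nonnegative.  Either move keeps the running sum in ]-B, B]. *)
Lemma balanced_ordering (I : finType) (w : I -> int) (B : nat) (S : {set I}) t :
  (0 < B)%N -> (forall i, i \in S -> `|w i| <= B%:Z) ->
  \sum_(i in S) w i = 0 -> (t <= #|S|)%N ->
  exists s : seq I, [/\ uniq s, {subset s <= S}, size s = t &
    forall q, - B%:Z < \sum_(i <- take q s) w i <= B%:Z].
Proof.
move=> B0 wB S0; elim: t => [|t IH] tS.
  by exists [::]; split => // q; rewrite big_nil; lia.
have [s [us sS szs bs]] := IH (ltnW tS).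
pose rest := S :\: [set i in s].
have sumE : \sum_(i <- s) w i = \sum_(i in [set i in s]) w i.
  by rewrite big_uniq //=; apply: eq_bigl => i; rewrite !inE.
have rsum : \sum_(i in rest) w i = - \sum_(i <- s) w i.
  apply/eqP; rewrite -addr_eq0 sumE addrC; apply/eqP; rewrite -[RHS]S0.
  rewrite [RHS](big_setID [set i in s]) /=; congr (_ + _).
  by apply: eq_bigl => i; rewrite !inE; case: (boolP (i \in s)) => [/sS ->|_]; rewrite ?andbF.
have cs : #|[set i in s]| = t by rewrite cardsE -szs; apply/card_uniqP.
have rest0 : (0 < #|rest|)%N.
  have := cardsD S [set i in s]; rewrite -/rest => ->.
  by rewrite subn_gt0 (leq_ltn_trans (subset_leq_card (subsetIr _ _))) // cs.
have bsw : - B%:Z < \sum_(i <- s) w i <= B%:Z by have := bs t; rewrite take_oversize ?szs.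
set sg := \sum_(i <- s) w i in rsum bsw.
(* A sum of terms of one sign cannot compensate a running sum of the same sign. *)
have [i ir iP] : exists2 i, i \in rest & (if 0 < sg then w i < 0 else 0 <= w i).
  case: (ltP 0 sg) => hs.
    case: (pickP [pred i in rest | w i < 0]) => [i /andP[ir wi]|no]; first by exists i.
    have : 0 <= \sum_(i in rest) w i.
      by apply: sumr_ge0 => i ir; have := no i; rewrite /= ir /= => /negbT; rewrite -leNgt.
    by rewrite rsum; lia.
  case: (pickP [pred i in rest | 0 <= w i]) => [i /andP[ir wi]|no]; first by exists i.
  have : \sum_(i in rest) w i < \sum_(i in rest) 0.
    apply: ltr_sum => [|i ir]; last by have := no i; rewrite /= ir /= => /negbT; rewrite -ltNge.
    by move/card_gt0P: rest0 => [i ir]; apply/hasP; exists i; rewrite ?mem_index_enum.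
  by rewrite big1_eq rsum; lia.
move: ir; rewrite !inE => /andP[iNs iS].
exists (rcons s i); split.
- by rewrite rcons_uniq iNs.
- by move=> j; rewrite mem_rcons inE => /orP[/eqP->|/sS].
- by rewrite size_rcons szs.
move=> q; case: (leqP q (size s)) => hq.
  by have := bs q; rewrite -cats1 takel_cat.
rewrite take_oversize ?size_rcons // -cats1 big_cat big_seq1 /=.
have := wB _ iS; case: ifP iP => hs; rewrite -/sg; lia.
Qed.

(** Pigeonhole on the partial sums of a balanced ordering: the 2B+1 sums indexed
    by 0,..,2B take at most 2B values, and the elements between two equal
    partial sums add up to 0. *)
Lemma short_zero_sum (I : finType) (w : I -> int) (B : nat) (S : {set I}) :
  (0 < B)%N -> (forall i, i \in S -> `|w i| <= B%:Z) ->
  (0 < #|S|)%N -> \sum_(i in S) w i = 0 ->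
  exists S' : {set I}, [/\ S' \subset S, (0 < #|S'| <= B.*2)%N &
    \sum_(i in S') w i = 0].
Proof.
move=> B0 wB Sp S0; case: (leqP #|S| B.*2) => [hS|hS].
  by exists S; rewrite subxx Sp hS S0.
have [s [us sS szs bs]] := balanced_ordering B0 wB S0 hS.
pose sg q : int := \sum_(i <- take q s) w i.
have B20 : (0 < B.*2)%N by lia.
(* Numbers the values of ]-B, B] by 0,..,2B-1; the default value is never used. *)
pose g (q : 'I_B.*2.+1) : 'I_B.*2 := insubd (Ordinal B20) `|(sg q + B%:Z - 1)%R|%N.
have /injectivePn [a [b ab gab]] : ~~ injectiveb g.
  by apply/injectiveP => /leq_card; rewrite !card_ord ltnn.
have gE q : (g q : nat) = `|(sg q + B%:Z - 1)%R|%N.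
  by rewrite /g val_insubd ifT //; have := bs q; rewrite -/(sg q); lia.
have sab : sg a = sg b.
  by have := congr1 val gab; rewrite /= !gE; have := bs a; have := bs b; rewrite -/(sg a) -/(sg b); lia.
wlog lab : a b ab gab sab / (a < b)%N.
  move=> H; have : val a != val b by [].
  rewrite neq_ltn => /orP[]; first exact: H.
  by apply: H => //; rewrite eq_sym.
pose s' := drop a (take b s).
have us' : uniq s' by rewrite drop_uniq ?take_uniq.
have cs' : #|[set i in s']| = (b - a)%N.
  have -> : #|[set i in s']| = size s' by rewrite cardsE; apply/card_uniqP.
  by rewrite size_drop size_takel // szs; apply: ltnW.
exists [set i in s']; split.
- by apply/subsetP => i; rewrite inE => /mem_drop /mem_take /sS.
- by rewrite cs'; have := ltn_ord b; lia.
have -> : \sum_(i in [set i in s']) w i = \sum_(i <- s') w i.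
  by rewrite [RHS]big_uniq //=; apply: eq_bigl => i; rewrite !inE.
have : sg b = sg a + \sum_(i <- s') w i.
  by rewrite /sg /s' -[take b s in LHS](cat_take_drop a) big_cat take_takel // ltnW.
by rewrite sab => /(congr1 (fun z => z - sg b)); rewrite subrr addrAC subrr add0r.
Qed.

Lemma zero_sum_partition (I : finType) (w : I -> int) (B : nat) (S : {set I}) :
  (0 < B)%N -> (forall i, i \in S -> `|w i| <= B%:Z) -> \sum_(i in S) w i = 0 ->
  exists P : {set {set I}}, partition P S /\
    forall X, X \in P -> (#|X| <= B.*2)%N /\ \sum_(i in X) w i = 0.
Proof.
move=> B0; have [N] := ubnP #|S|; elim: N S => // N IH S hS wB S0.
have [Sz|Sp] := posnP #|S|.
  exists finset.set0; split; last by move=> X; rewrite inE.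
  by rewrite (cards0_eq Sz) partition_set0.
have [X [XS /andP[X0 XB] sX]] := short_zero_sum B0 wB Sp S0.
have [] := IH (S :\: X).
- by rewrite cardsDS //; lia.
- by move=> i; rewrite inE => /andP[_]; apply: wB.
- by have := S0; rewrite (big_setID X) /= (setIidPr XS) sX add0r.
move=> P [pP HP]; exists (X |: P); split; last first.
  by move=> Y; rewrite !inE => /orP[/eqP->|/HP].
have -> : S = X :|: (S :\: X) by rewrite -[LHS](setID S X) (setIidPr XS).
apply: partitionU1 => //; first by rewrite -card_gt0.
by rewrite disjoints_subset; apply/subsetP => i iX; rewrite !inE iX.
Qed.

(** Blocks of at most 2k elements on which a cancels have b-sums of absolute
    value at most 2k^2, so the one-dimensional statement, applied to the blocks,
    finds at most 4k^2 of them on which b cancels as well. *)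
Lemma short_zero_sum2 (I : finType) (a b : I -> int) (k : nat) (S : {set I}) :
  (0 < k)%N -> (forall i, i \in S -> `|a i| <= k%:Z) ->
  (forall i, i \in S -> `|b i| <= k%:Z) -> (0 < #|S|)%N ->
  \sum_(i in S) a i = 0 -> \sum_(i in S) b i = 0 ->
  exists S' : {set I}, [/\ S' \subset S, (0 < #|S'| <= (2 * k) ^ 3)%N,
    \sum_(i in S') a i = 0 & \sum_(i in S') b i = 0].
Proof.
move=> k0 ak bk Sp a0 b0.
have [P [pP HP]] := zero_sum_partition k0 ak a0.
have [covP tiP P0] := and3P pP.
pose b' (X : {set I}) : int := \sum_(i in X) b i.
have PS X : X \in P -> X \subset S.
  by move=> XP; rewrite -(eqP covP); apply: bigcup_sup.
have b'k X : X \in P -> `|b' X| <= (k.*2 * k)%N%:Z.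
  move=> XP; apply: le_trans (ler_norm_sum _ _ _) _.
  have [cX _] := HP _ XP.
  apply: (@le_trans _ _ (\sum_(i in X) k%:Z)).
    by apply: ler_sum => i iX; apply: bk; apply: (subsetP (PS _ XP)).
  by rewrite sumr_const; nia.
have Pp : (0 < #|P|)%N.
  rewrite lt0n; apply: contraTneq Sp => /cards0_eq Pe.
  by rewrite -(eqP covP) Pe /cover big_set0 cards0.
have b'0 : \sum_(X in P) b' X = 0.
  by rewrite -[RHS]b0 -(eqP covP) (big_trivIset _ tiP).
have kk : (0 < k.*2 * k)%N by nia.
have [Q [QP /andP[Q0 Qk] bQ]] := short_zero_sum kk b'k Pp b'0.
have tiQ : trivIset Q by apply: trivIsetS tiP.
exists (cover Q); split.
- by apply/bigcupsP => X /(subsetP QP) /PS.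
- move/card_gt0P: Q0 => [X XQ]; apply/andP; split.
    have XP := subsetP QP _ XQ.
    have : X \subset cover Q by apply: bigcup_sup.
    move/subset_leq_card; apply: leq_trans; rewrite card_gt0.
    by apply: contraNneq P0 => <-.
  have /eqP <- : trivIset Q := tiQ.
  have : (\sum_(X in Q) #|X| <= \sum_(X in Q) k.*2)%N.
    by apply: leq_sum => Y /(subsetP QP) /HP [].
  by rewrite sum_nat_const; nia.
- by rewrite (big_trivIset _ tiQ) big1 //= => X /(subsetP QP) /HP [].
- by rewrite (big_trivIset _ tiQ).
Qed.

Lemma reducible_above3 k : (0 < k)%N -> reducible_above 3 k ((2 * k) ^ 3).
Proof.
move=> k0 m mk A Ak Al; apply/reducibleP.
pose d (j : 'I_3) i : int := (A i j)%:Z - (A i ord0)%:Z.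
have sumd (E : {set 'I_m}) j : \sum_(i in E) d j i =
    (\sum_(i in E) A i j)%N%:Z - (\sum_(i in E) A i ord0)%N%:Z.
  by rewrite /d sumrB !(rmorph_sum Posz).
have dk j i : i \in [set: 'I_m] -> `|d j i| <= k%:Z.
  by move=> _; rewrite /d; have := Ak i j; have := Ak i ord0; lia.
have d0 j : \sum_(i in [set: 'I_m]) d j i = 0.
  by rewrite sumd !big_setT_ord (Al j ord0) subrr.
have [|E [_ /andP[E0 cE] a0 b0]] := @short_zero_sum2 _ (d (inord 1)) (d (inord 2)) k
  [set: 'I_m] k0 (dk _) (dk _) _ (d0 _) (d0 _).
  by rewrite cardsT card_ord; lia.
exists E; split; first by rewrite E0 (leq_ltn_trans cE).
suff H j : (\sum_(i in E) A i j = \sum_(i in E) A i ord0)%N.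
  by move=> j1 j2; rewrite !H.
move/eqP: a0; rewrite sumd subr_eq0 eqz_nat => /eqP a0.
move/eqP: b0; rewrite sumd subr_eq0 eqz_nat => /eqP b0.
case: j => [[|[|[|j]]] hj] //.
- by rewrite (_ : Ordinal hj = ord0) //; apply/val_inj.
- by rewrite (_ : Ordinal hj = inord 1) //; apply/val_inj; rewrite /= inordK.
- by rewrite (_ : Ordinal hj = inord 2) //; apply/val_inj; rewrite /= inordK.
Qed.

(** * Hadamard's inequality and bordered determinants *)

(** Induction through the Schur complement: if the corner g of
    G = [g, b; b^T, G'] is positive, then det G = g det (G' - b^T b / g), the
    Schur complement is again positive semidefinite, and its diagonal is
    dominated by that of G'.  If g = 0 then positivity forces b = 0. *)
Lemma det_psd_le_diag (R : realFieldType) n (G : 'M[R]_n) :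
  G^T = G -> (forall u : 'rV_n, 0 <= (u *m G *m u^T) 0 0) ->
  \det G <= \prod_i G i i.
Proof.
elim: n G => [|n IH] G Gs Gp; first by rewrite det_mx00 big_ord0.
have diag_ge0 i : 0 <= G i i.
  have := Gp (delta_mx 0 i); rewrite -rowE trmx_delta -colE; by rewrite !mxE.
pose g : R := G 0 0; pose b : 'rV_n := @ursubmx _ 1 n 1 n G; pose G' : 'M[R]_n := @drsubmx _ 1 n 1 n G.
have GE : G = block_mx g%:M b b^T G' :> 'M[R]_(1 + n).
  rewrite -[LHS](@submxK _ 1 n 1 n); congr block_mx.
    by apply/matrixP => i j; rewrite !ord1 !mxE mulr1n /g; congr (G _ _); apply/val_inj.
  by rewrite /b trmx_ursub Gs.
have Gp' (u : 'rV_(1 + n)) :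
    0 <= (u *m (block_mx g%:M b b^T G' : 'M[R]_(1 + n)) *m u^T) 0 0.
  by rewrite -GE; apply: Gp.
have G's : G'^T = G' by rewrite /G' trmx_drsub Gs.
have prodE : \prod_i G i i = g * \prod_i G' i i.
  rewrite big_ord_recl; congr (_ * _); apply: eq_bigr => i _.
  by rewrite /G' !mxE; congr (G _ _); apply/val_inj.
have g_ge0 : 0 <= g by apply: diag_ge0.
rewrite prodE; clearbody b G' g.
have quad (a : R) (u : 'rV_n) :
    0 <= a ^+ 2 * g + 2 * a * (u *m b^T) 0 0 + (u *m G' *m u^T) 0 0.
  have := Gp' (row_mx a%:M u); rewrite mul_row_block tr_row_mx mul_row_col.
  rewrite tr_scalar_mx !mulmxDl !mul_mx_scalar !mul_scalar_mx.
  rewrite -!scalemxAl; have -> : b *m u^T = (u *m b^T)^T by rewrite trmx_mul trmxK.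
  move: (u *m b^T) (u *m G' *m u^T) => q h; rewrite !mxE mulr1n.
  by move/le_trans; apply; rewrite le_eqVlt; apply/orP; left; apply/eqP; ring.
have [g0|gn0] := eqVneq g 0.
  have b0 : b = 0.
    pose q : R := (b *m b^T) 0 0; pose h : R := (b *m G' *m b^T) 0 0.
    (* Otherwise the form would be negative at (a, b) for a suitable negative a. *)
    have q0 : q <= 0.
      rewrite leNgt; apply/negP => qp.
      have := quad (- (h + 1) / (2 * q)) b; rewrite g0 -/q -/h mulr0 add0r.
      have -> : 2 * (- (h + 1) / (2 * q)) * q = - (h + 1) by field; rewrite ?lt0r_neq0.
      lra.
    apply/rowP => j; rewrite mxE; apply/eqP; rewrite -sqrf_eq0.
    have : \sum_j b 0 j ^+ 2 <= 0.
      by move: q0; rewrite /q mxE; under eq_bigr do rewrite !mxE -expr2.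
    rewrite le_eqVlt ltNge sumr_ge0 ?orbF => [|i _]; last exact: sqr_ge0.
    rewrite psumr_eq0 => [/allP/(_ j)|i _]; last exact: sqr_ge0.
    by rewrite mem_index_enum => /(_ isT).
  suff -> : \det G = 0 by rewrite g0 mul0r.
  rewrite [G]GE b0 g0 trmx0 raddf0 (@det_ublock _ 1 n) det0 //.
  by rewrite mul0r.
have gp : 0 < g by rewrite lt_def gn0.
pose S := G' - g^-1 *: (b^T *m b).
have detE : \det G = g * \det S.
  have : block_mx 1%:M 0 (- g^-1 *: b^T) 1%:M *m (block_mx g%:M b b^T G' : 'M[R]_(1+n))
       = block_mx g%:M b 0 S.
    rewrite mulmx_block !mul1mx !mul0mx !addr0; congr block_mx.
      by rewrite mul_mx_scalar scalerA mulrN divff // scaleN1r addNr.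
    by rewrite -scalemxAl scaleNr addrC.
  move/(congr1 determinant); rewrite det_mulmx det_lblock !det1 !mul1r -GE => ->.
  by rewrite det_ublock det_scalar1.
rewrite detE ler_pM2l //.
apply: le_trans (IH S _ _) _.
- by rewrite /S raddfB /= linearZ /= trmx_mul trmxK G's.
(* The form of S at u is the minimum over a of the form of G at (a, u). *)
- move=> u; have := quad (- (u *m b^T) 0 0 / g) u.
  rewrite /S mulmxBr mulmxBl -scalemxAr -scalemxAl mulmxA.
  have E2 : u *m b^T *m b *m u^T = (u *m b^T) *m (u *m b^T)^T.
    by rewrite trmx_mul trmxK mulmxA.
  rewrite E2; move: (u *m G' *m u^T) (u *m b^T) => h q.
  have -> : (h - g^-1 *: (q *m q^T)) 0 0 = h 0 0 - g^-1 * (q 0 0) ^+ 2.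
    by rewrite !mxE big_ord1 mxE expr2.
  have -> : (- q 0 0 / g) ^+ 2 * g + 2 * (- q 0 0 / g) * q 0 0 + h 0 0
     = h 0 0 - g^-1 * q 0 0 ^+ 2 by field.
  by [].
have Sge i : 0 <= S i i.
  have := quad (- (b 0 i) / g) (delta_mx 0 i).
  rewrite -!rowE trmx_delta -colE !mxE.
  rewrite big_ord1 !mxE.
  by congr (_ <= _); field.
apply: ler_prod => i _; rewrite Sge /= !mxE big_ord1 !mxE lerBlDr lerDl.
by rewrite mulr_ge0 ?invr_ge0 ?(ltW gp) // -expr2 sqr_ge0.
Qed.

(** The Gram matrix A A^T is positive semidefinite, has determinant (det A)^2,
    and its diagonal consists of squared row norms, each at most n. *)
Lemma hadamard (R : realFieldType) n (A : 'M[R]_n) :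
  (forall i j, `|A i j| <= 1) -> (\det A) ^+ 2 <= n%:R ^+ n.
Proof.
move=> A1; have -> : (\det A) ^+ 2 = \det (A *m A^T) by rewrite det_mulmx det_tr expr2.
apply: le_trans (det_psd_le_diag _ _) _.
- by rewrite trmx_mul trmxK.
- move=> u; rewrite mulmxA -mulmxA -trmx_mul mxE sumr_ge0 // => i _.
  by rewrite !mxE -expr2 sqr_ge0.
rewrite -[X in _ ^+ X](card_ord n) -prodr_const; apply: ler_prod => i _.
rewrite mxE sumr_ge0 => [|j _] /=; last by rewrite !mxE -expr2 sqr_ge0.
rewrite -[X in _ <= X%:R](card_ord n) -sumr_const; apply: ler_sum => j _.
by rewrite !mxE -expr2 -real_normK ?num_real // exprn_ile1.
Qed.

(** Row and column operations with the border replace V by (2/k) V - 1, whose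
    entries lie in [-1, 1], at the cost of a factor (k/2)^p.  Treating the
    matrix as one with entries in [0, k] would lose a factor of order 2^p. *)
Lemma bordered_det_le (R : realFieldType) p (k : R) (V : 'M[R]_p.+1) :
  0 < k -> (forall i j, 0 <= V i j <= k) ->
  (\det (block_mx V (const_mx 1) (const_mx 1) 0 : 'M[R]_(p.+1 + 1))) ^+ 2
    <= (k / 2) ^+ p ^+ 2 * p.+2%:R ^+ p.+2.
Proof.
move=> k0 Vk.
pose c := 2 / k; have c0 : c != 0 by rewrite /c mulf_neq0 ?invr_neq0 ?gt_eqF.
set B := block_mx _ _ _ _.
pose B' : 'M[R]_(p.+1 + 1) := block_mx (c *: V - const_mx 1) (const_mx 1) (const_mx 1) 0.
have BB' : (block_mx c%:M (const_mx (-1)) 0 1%:M : 'M[R]_(p.+1 + 1)) *m B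
     *m block_mx 1%:M 0 0 (c^-1)%:M = B'.
  rewrite /B !mulmx_block !mul1mx !mul0mx !mulmx0 !mulmx1 ?addr0 ?add0r; congr block_mx.
  - rewrite mul_scalar_mx; congr (_ + _); apply/matrixP => i j.
    by rewrite !mxE big_ord1 !mxE mulN1r.
  - by rewrite mul_mx_scalar mul_scalar_mx scalerA mulVf // scale1r.
  - by rewrite mul0mx.
have detE : \det B = (k / 2) ^+ p * \det B'.
  have := congr1 determinant BB'.
  rewrite !det_mulmx det_ublock det_lblock !det1 !mul1r mulr1 !det_scalar expr1 => <-.
  rewrite exprS /c expr_div_n [in RHS]expr_div_n; field.
  by rewrite gt_eqF // !expf_eq0 !gt_eqF // !andbF.
rewrite detE exprMn ler_wpM2l ?sqr_ge0 // -[in X in _ <= X](addn1 p.+1).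
apply: hadamard => i j; rewrite -(splitK i) -(splitK j) /B'.
case: (split i) => i'; case: (split j) => j' /=;
  rewrite ?block_mxEul ?block_mxEur ?block_mxEdl ?block_mxEdr !mxE ?normr1 ?normr0 //.
rewrite ler_norml; have /andP[V0 V1] := Vk i' j'.
have : c * V i' j' <= 2.
  by rewrite /c mulrAC ler_pdivrMr // ler_pM2l.
have : 0 <= c * V i' j' by rewrite mulr_ge0 // divr_ge0 // ltW.
by move=> *; apply/andP; split; lra.
Qed.

(** * Level weights as combinations of small integral rays *)

(** Passing from n to n+1 multiplies the bound by (k/2)^2 (n+3)^(n+3) / (n+2)^(n+2),
    and Bernoulli's inequality gives (n+3)^(n+2) >= 2 (n+2)^(n+2). *)
Lemma det_bound_mono (R : realFieldType) (k : R) p n : 1 <= k -> (p <= n)%N ->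
  (k / 2) ^+ p ^+ 2 * p.+2%:R ^+ p.+2 <= (k / 2) ^+ n ^+ 2 * n.+2%:R ^+ n.+2.
Proof.
move=> k1; elim: n => [|n IH]; first by rewrite leqn0 => /eqP->.
rewrite leq_eqVlt => /orP[/eqP->//|]; rewrite ltnS => /IH /le_trans; apply.
have bern : 2 * n.+2%:R ^+ n.+2 <= n.+3%:R ^+ n.+2 :> R.
  have -> : (n.+3%:R : R) = n.+2%:R * (1 + n.+2%:R^-1).
    by rewrite mulrDr mulr1 divff ?pnatr_eq0 // -natr1.
  rewrite exprMn mulrC ler_pM2l ?exprn_gt0 ?ltr0n //.
  have H (m : nat) (t : R) : 0 <= t -> 1 + m%:R * t <= (1 + t) ^+ m.
    move=> t0; elim: m => [|m IHm]; first by rewrite mul0r addr0 expr0.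
    rewrite exprS; have : (1 + t) * (1 + m%:R * t) <= (1 + t) * (1 + t) ^+ m.
      by rewrite ler_wpM2l // addr_ge0.
    apply: le_trans; rewrite -natr1; have : 0 <= m%:R * t * t by rewrite !mulr_ge0.
    by lra.
  apply: le_trans (H _ _ _); last by rewrite invr_ge0.
  by rewrite divff ?pnatr_eq0.
rewrite -!exprM; set X := (k / 2); set a := n.+2%:R ^+ _ in bern *; set b := n.+3%:R ^+ _ in bern *.
have a0 : 0 <= a by rewrite exprn_ge0.
have -> : X ^+ (n.+1 * 2) = X ^+ (n * 2) * X ^+ 2 by rewrite -exprD; congr (_ ^+ _); lia.
rewrite -mulrA ler_wpM2l ?exprn_ge0 //; first by rewrite /X; lra.
rewrite (exprS n.+3%:R) -/b.
have X2 : 4^-1 <= X ^+ 2.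
  have -> : 4^-1 = 2^-1 ^+ 2 :> R by field.
  by rewrite ler_pXn2r // ?nnegrE /X; lra.
have n3 : 2 <= n.+3%:R :> R by rewrite ler_nat.
have b0 : 0 <= b by rewrite exprn_ge0.
have : 2 * b <= n.+3%:R * b by rewrite ler_wpM2r.
have : 4^-1 * (n.+3%:R * b) <= X ^+ 2 * (n.+3%:R * b) by rewrite ler_wpM2r // mulr_ge0.
move: (X ^+ 2) (n.+3%:R * b) (X ^+ 2 * _) => Y c e; lra.
Qed.

(** The hypothesis on w says that, up to scaling, y is the only level weight on
    the rows of V: a level weight that vanishes at i0 is zero.  Then V with a
    row of ones appended has rank p+1, so p+1 columns of it carry all the
    relations, and bordering them gives an invertible matrix N that maps (y, -d)
    to (0, sum y).  Multiplying by the adjugate of N expresses det N times y as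
    sum y times a row of integer cofactors; so the total of the integral
    multiple of y is |det N|. *)
Lemma integral_ray (R : realFieldType) p n (k : nat) (V : 'I_p.+1 -> 'I_n -> nat)
    (y : 'rV[R]_p.+1) (d : R) (i0 : 'I_p.+1) :
  (0 < k)%N -> (0 < n)%N -> (forall i j, V i j <= k)%N ->
  (forall i, 0 < y 0 i) ->
  (forall j, \sum_i y 0 i * (V i j)%:R = d) ->
  (forall (w : 'rV[R]_p.+1) e, (forall j, \sum_i w 0 i * (V i j)%:R = e) ->
      w 0 i0 = 0 -> w = 0) ->
  exists (a : R) (r : 'I_p.+1 -> nat), [/\ 0 < a, forall i, (r i)%:R = a * y 0 i,
    (a * \sum_i y 0 i) ^+ 2 <= (k%:R / 2) ^+ p ^+ 2 * p.+2%:R ^+ p.+2 & (p < n)%N].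
Proof.
move=> k0 n0 Vk y0 yd yuniq.
pose VR : 'M[R]_(p.+1, n) := \matrix_(i, j) (V i j)%:R.
pose M : 'M[R]_(p.+1 + 1, n) := col_mx VR (const_mx 1).
pose yb : 'rV_(p.+1 + 1) := row_mx y (- d)%:M.
have mulVR (w : 'rV_p.+1) j : (w *m VR) 0 j = \sum_i w 0 i * (V i j)%:R.
  by rewrite mxE; apply: eq_bigr => i _; rewrite mxE.
have ybM : yb *m M = 0.
  apply/rowP => j; rewrite mul_row_col mxE mulVR yd.
  by rewrite mxE big_ord1 !mxE mulr1n mulr1 subrr.
have ker u : u *m M = 0 -> exists a, u = a *: yb.
  move=> uM; pose a := u 0 (lshift 1 i0) / y 0 i0; exists a.
  have uj j : \sum_i u 0 (lshift 1 i) * (V i j)%:R = - u 0 (rshift p.+1 0).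
    have /rowP/(_ j) := uM; rewrite -{1}[u]hsubmxK mul_row_col mxE mulVR.
    rewrite [X in _ + X]mxE big_ord1 !mxE mulr1 => /eqP; rewrite addr_eq0 => /eqP <-.
    by apply: eq_bigr => i _; rewrite mxE.
  have w0 : lsubmx u - a *: y = 0.
    apply: (@yuniq _ (- u 0 (rshift p.+1 0) - a * d)).
      move=> j; rewrite -(uj j) -(yd j) mulr_sumr -sumrB; apply: eq_bigr => i _.
      by rewrite !mxE mulrBl mulrA.
    by rewrite !mxE /a divfK ?subrr // gt_eqF.
  have lu i : u 0 (lshift 1 i) = a * y 0 i.
    by have /rowP/(_ i) := w0; rewrite !mxE => /eqP; rewrite subr_eq0 => /eqP.
  apply/rowP => i; rewrite -(splitK i); case: (split i) => i' /=.
    by rewrite mxE row_mxEl lu.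
  rewrite mxE row_mxEr !ord1 mxE mulr1n mulrN.
  rewrite -[LHS]opprK -(uj (Ordinal n0)) -(yd (Ordinal n0)).
  rewrite mulr_sumr; congr (- _); apply: eq_bigr => l _.
  by rewrite lu mulrA.
have yb0 : yb != 0.
  apply/eqP => /rowP/(_ (lshift 1 i0)); rewrite row_mxEl mxE => /eqP.
  by rewrite gt_eqF.
have rkM : \rank M = p.+1.
  have /eqmx_rank : (kermx M == yb)%MS.
    apply/andP; split; last by apply/sub_kermxP.
    by apply/rV_subP => u /sub_kermxP /ker [a ->]; rewrite scalemx_sub.
  by rewrite mxrank_ker rank_rV yb0; have := rank_leq_row M; lia.
have pn : (p < n)%N by rewrite -rkM rank_leq_col.
(* The columns selected by f span all the columns of M. *)
have [f fE] : exists f : 'I_p.+1 -> 'I_n, (M^T <= rowsub f M^T)%MS.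
  have := eq_maxrowsub M^T; move: (maxrankfun M^T).
  by rewrite mxrank_tr rkM => f E; exists f; rewrite E.
pose NZ : 'M[int]_(p.+1 + 1) :=
  block_mx (\matrix_(i, j) (V i (f j))%:Z) (const_mx 1) (const_mx 1) 0.
pose N : 'M[R]_(p.+1 + 1) := map_mx intr NZ.
have NE : N = block_mx (colsub f VR) (const_mx 1) (const_mx 1) 0.
  rewrite /N /NZ map_block_mx !map_const_mx raddf0; congr block_mx.
  by apply/matrixP => i j; rewrite !mxE.
have NE2 : N = row_mx (colsub f M) (col_mx (const_mx 1) 0).
  rewrite NE block_mxEh; congr row_mx; apply/matrixP => i j.
  rewrite [RHS]mxE -(splitK i) /M; case: (split i) => i' /=.
    by rewrite !col_mxEu mxE.
  by rewrite !col_mxEd !mxE.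
pose s := \sum_i y 0 i.
have s0 : 0 < s.
  rewrite /s (bigD1 i0) //= ltr_pwDl // sumr_ge0 // => i _; exact: ltW.
have ybc : yb *m col_mx (const_mx 1) 0 = s%:M.
  rewrite mul_row_col mulmx0 addr0; apply/matrixP => i j.
  rewrite !ord1 !mxE mulr1n; apply: eq_bigr => l _; by rewrite mxE mulr1.
have ybN : yb *m N = row_mx 0 s%:M.
  by rewrite NE2 mul_mx_row ybc mulmx_colsub ybM; congr row_mx; apply/matrixP => i j; rewrite !mxE.
(* A row vector killed by N is killed by M, hence is a multiple of yb, and the last
   column of N shows that the multiple is 0. *)
have dN : \det N != 0.
  rewrite -unitfE -unitmxE -row_free_unit -kermx_eq0; apply/eqP/row_matrixP => i.
  rewrite row0; set u := row i _.
  have : u *m N = 0 by apply/sub_kermxP; apply: row_sub.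
  rewrite NE2 mul_mx_row -(row_mx0 _ _ p.+1 1) => /eq_row_mx [uM uc].
  have [a ua] : exists a, u = a *: yb.
    apply: ker; apply: trmx_inj; rewrite trmx_mul trmx0.
    have /submxP [D ->] := fE; rewrite -mulmxA.
    have -> : rowsub f M^T = (colsub f M)^T by apply/matrixP => ? ?; rewrite !mxE.
    by rewrite -trmx_mul uM trmx0 mulmx0.
  move: uc; rewrite ua -scalemxAl ybc => /matrixP/(_ 0 0).
  rewrite !mxE mulr1n => /eqP; rewrite mulf_eq0 (gt_eqF s0) orbF => /eqP->.
  by rewrite scale0r row_mx0.
(* Computed from the integer matrix NZ, so that W i is an integer. *)
pose W i : int := (\adj NZ) (rshift p.+1 0) (lshift 1 i).
have WE i : \det N * y 0 i = s * (W i)%:~R.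
  have : (\det N *: yb) 0 (lshift 1 i) = (row_mx 0 s%:M *m \adj N) 0 (lshift 1 i).
    by rewrite -ybN -mulmxA mul_mx_adj mul_mx_scalar.
  rewrite mxE row_mxEl => ->.
  rewrite -[\adj N]vsubmxK mul_row_col mul0mx add0r mul_scalar_mx !mxE.
  by rewrite /N cofactor_map_mx /W mxE.
exists (`|\det N| / s), (fun i => `|W i|%N); split => //.
- by rewrite divr_gt0 // normr_gt0.
- move=> i; rewrite natr_absz intr_norm.
  have -> : (W i)%:~R = \det N * y 0 i / s by rewrite WE mulrAC divff ?mul1r ?gt_eqF.
  by rewrite !normrM normfV (gtr0_norm s0) (gtr0_norm (y0 i)) mulrAC.
- rewrite -/s divfK ?gt_eqF // real_normK ?num_real // NE.
  apply: bordered_det_le; first by rewrite ltr0n.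
  by move=> i j; rewrite !mxE ler0n ler_nat Vk.
Qed.

(** The vectors [v u] are the possible rows and [x u] is the multiplicity, maybe
    fractional, with which [v u] is used; natural number multiplicities that
    are balanced are level matrices. *)
Definition balanced (R : realFieldType) (U : finType) n (v : U -> 'I_n -> nat)
    (x : U -> R) : Prop :=
  forall j1 j2, \sum_u x u * (v u j1)%:R = \sum_u x u * (v u j2)%:R.

Lemma balanced_lin (R : realFieldType) (U : finType) n (v : U -> 'I_n -> nat)
    (x y : U -> R) (a : R) :
  balanced v x -> balanced v y -> balanced v (fun u => x u - a * y u).
Proof.
move=> bx By j1 j2.
have E j : \sum_u (x u - a * y u) * (v u j)%:R =
    \sum_u x u * (v u j)%:R - a * \sum_u y u * (v u j)%:R.
  by rewrite mulr_sumr -sumrB; apply: eq_bigr => u _; rewrite mulrBl mulrA.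
by rewrite !E (bx j1 j2) (By j1 j2).
Qed.

Lemma enum_set_bij (U : finType) (S : {set U}) p : #|S| = p.+1 ->
  exists (e : 'I_p.+1 -> U) (g : U -> 'I_p.+1),
    [/\ forall i, e i \in S, cancel e g & {in S, cancel g e}].
Proof.
move=> Sp; have [x0 x0S] : exists x, x \in S by apply/card_gt0P; rewrite Sp.
exists (fun i => enum_val (cast_ord (esym Sp) i)).
exists (fun u => cast_ord Sp (enum_rank_in x0S u)); split.
- by move=> i; apply: enum_valP.
- by move=> i; rewrite enum_valK_in cast_ordKV.
- by move=> u uS; rewrite cast_ordK enum_rankK_in.
Qed.

(** The usual move along an edge of a polyhedron: subtract the largest multiple of w
    that keeps all weights nonnegative, so that a weight of y drops to 0.  That
    w vanishes at u0 ensures that the result is not zero. *)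
Lemma peel_kernel (R : realFieldType) (U : finType) n (v : U -> 'I_n -> nat)
    (y w : U -> R) (u0 : U) :
  (forall u, 0 <= y u) -> 0 < y u0 -> balanced v y ->
  balanced v w -> (forall u, y u = 0 -> w u = 0) -> w u0 = 0 -> (exists u, w u != 0) ->
  exists y' : U -> R, [/\ forall u, 0 <= y' u, 0 < y' u0, balanced v y',
    forall u, y u = 0 -> y' u = 0 & exists u, y u != 0 /\ y' u = 0].
Proof.
move=> y0 yu0 By Bw wsupp wu0 [u1 wu1].
wlog wp : w Bw wsupp wu0 wu1 / 0 < w u1.
  move=> H; case: (ltP 0 (w u1)) => [|wn]; first exact: (H w).
  apply: (H (fun u => 0 - 1 * w u)).
  - by apply: balanced_lin => // j1 j2; rewrite !big1 // => u _; rewrite mul0r.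
  - by move=> u /wsupp ->; rewrite mulr0 subrr.
  - by rewrite wu0 mulr0 subrr.
  - by rewrite mul1r sub0r oppr_eq0.
  - by rewrite mul1r sub0r oppr_gt0 lt_def eq_sym wu1.
have [u2 w2 min2] : exists2 u2, 0 < w u2 & forall u, 0 < w u -> y u2 / w u2 <= y u / w u.
  by case: (@arg_minP _ _ _ u1 (fun u => 0 < w u) (fun u => y u / w u) wp) => u2 ? H; exists u2.
pose l := y u2 / w u2.
have l0 : 0 <= l by rewrite divr_ge0 // ltW.
exists (fun u => y u - l * w u); split.
- move=> u; rewrite subr_ge0; case: (ltP 0 (w u)) => [wu|wu].
    by rewrite -ler_pdivlMr // min2.
  by apply: le_trans (y0 u); rewrite mulr_ge0_le0.
- by rewrite wu0 mulr0 subr0.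
- exact: balanced_lin.
- by move=> u yu; rewrite yu (wsupp _ yu) mulr0 subrr.
- exists u2; split; last by rewrite /l divfK ?subrr // gt_eqF.
  by apply/eqP => /wsupp E; rewrite E ltxx in w2.
Qed.

(** As long as another level weight vanishing at a point u0 of the support exists,
    it can be used to shrink the support; when none exists, [integral_ray]
    applies.  The support then has at most n+1 elements, the number of columns,
    so monotonicity of the determinant bound finishes. *)
Lemma small_ray (R : realFieldType) (U : finType) n k (v : U -> 'I_n.+1 -> nat)
    (y : U -> R) :
  (0 < k)%N -> (forall u j, v u j <= k)%N ->
  (forall u, 0 <= y u) -> (exists u, 0 < y u) -> balanced v y ->
  exists r : U -> nat, [/\ balanced v (fun u => (r u)%:R : R), exists u, (0 < r u)%N,
    forall u, y u = 0 -> r u = 0%N &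
    (\sum_u (r u)%:R : R) ^+ 2 <= (k%:R / 2) ^+ n ^+ 2 * n.+2%:R ^+ n.+2].
Proof.
move=> k0 vk; have [N] := ubnP #|[set u | y u != 0]|.
elim: N y => // N IH y; rewrite ltnS => cN y0 [u0 yu0] By.
have [[w [Bw wsupp wu0 w0]]|now] := pselect (exists w : U -> R,
  [/\ balanced v w, forall u, y u = 0 -> w u = 0, w u0 = 0 & exists u, w u != 0]).
  have [y' [y'0 y'u0 By' supp' [u2 [yu2 y'u2]]]] := peel_kernel y0 yu0 By Bw wsupp wu0 w0.
  have [||||r [Br rp rsupp rb]] := IH y' => //; last 1 first.
  - by exists r; split => // u /supp' /rsupp.
  - apply: leq_trans cN; apply: proper_card; apply/properP; split.
      by apply/subsetP => u; rewrite !inE; apply: contra_neq => /supp'.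
    by exists u2; rewrite !inE ?y'u2 ?eqxx.
  - by exists u0.
set S := [set u | y u != 0] in cN.
have u0S : u0 \in S by rewrite inE gt_eqF.
have [p Sp] : exists p, #|S| = p.+1.
  have : (0 < #|S|)%N by apply/card_gt0P; exists u0.
  by case: #|S| => // p _; exists p.
have [e [g [eS eK gK]]] := enum_set_bij Sp.
have sumE (F : U -> R) : (forall u, y u = 0 -> F u = 0) -> \sum_u F u = \sum_i F (e i).
  move=> F0; rewrite (bigID (mem S)) /= [X in _ + X]big1 ?addr0.
    by rewrite (reindex_onto e g) //=; apply: eq_bigl => i; rewrite eS eK eqxx.
  by move=> u; rewrite inE negbK => /eqP /F0.
have [] := @integral_ray R p n.+1 k (fun i => v (e i)) (\row_i y (e i))
  (\sum_u y u * (v u ord0)%:R) (g u0) k0 isT.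
- by [].
- by move=> i; rewrite mxE lt_def y0 andbT; have := eS i; rewrite inE.
- move=> j; rewrite (By ord0 j) (sumE (fun u => y u * (v u j)%:R)) => [|u ->]; last by rewrite mul0r.
  by apply: eq_bigr => i _; rewrite mxE.
- move=> w c wc wu0; apply/eqP; apply: contra_notT now => w0.
  exists (fun u => if u \in S then w 0 (g u) else 0); split.
  + have E j : \sum_u (if u \in S then w 0 (g u) else 0) * (v u j)%:R = c.
      rewrite (sumE (fun u => (if u \in S then w 0 (g u) else 0) * (v u j)%:R)).
        by rewrite -(wc j); apply: eq_bigr => i _; rewrite eS eK.
      by move=> u yu; rewrite inE yu eqxx mul0r.
    by move=> j1 j2; rewrite !E.
  + by move=> u yu; rewrite inE yu eqxx.
  + by rewrite u0S.
  + have [i wi] : exists i, w 0 i != 0.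
      apply/existsP; apply: contraNT w0; rewrite negb_exists => /forallP H.
      by apply/eqP/rowP => i; rewrite mxE; have := H i; rewrite negbK => /eqP.
    by exists (e i); rewrite eS eK.
move=> a [r [a0 ra rb pn]].
have rE u : (if u \in S then r (g u) else 0)%N%:R = a * y u :> R.
  case: ifP => uS; first by rewrite ra mxE gK.
  by move: uS; rewrite inE => /negbFE/eqP ->; rewrite mulr0.
exists (fun u => if u \in S then r (g u) else 0%N); split.
- move=> j1 j2; under eq_bigr do rewrite rE -mulrA.
  under [RHS]eq_bigr do rewrite rE -mulrA.
  by rewrite -!mulr_sumr (By j1 j2).
- by exists u0; rewrite -(ltr0n R) rE mulr_gt0.
- by move=> u yu; rewrite inE yu eqxx.
under eq_bigr do rewrite rE.
rewrite -mulr_sumr (sumE y) //.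
apply: le_trans (det_bound_mono _ (_ : (p <= n)%N)) => //; last by rewrite ler1n.
by move: rb; under eq_bigr do rewrite mxE.
Qed.

(** Induction on the support of y.  Subtract from y the largest multiple l of a small
    integral weight r that keeps it nonnegative: this removes an element from
    the support.  If l < 1 the total decreases by at most C.  If l >= 1 then
    r <= y <= x, and irreducibility of x gives r = x, so that C alone bounds the
    total of y. *)
Lemma irreducible_weight_le (R : realFieldType) (U : finType) n (v : U -> 'I_n -> nat)
    (x : U -> nat) (C : R) :
  (forall r : U -> nat, balanced v (fun u => (r u)%:R : R) ->
     (exists u, 0 < r u)%N -> (forall u, r u <= x u)%N -> r =1 x) ->
  (forall y : U -> R, (forall u, 0 <= y u) -> (exists u, 0 < y u) -> balanced v y ->
     exists r : U -> nat, [/\ balanced v (fun u => (r u)%:R : R), exists u, (0 < r u)%N,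
       forall u, y u = 0 -> r u = 0%N & \sum_u (r u)%:R <= C]) ->
  forall y : U -> R, (forall u, 0 <= y u <= (x u)%:R) -> balanced v y ->
  \sum_u y u <= #|[set u | y u != 0]|%:R * C.
Proof.
move=> irr ray y; have [N] := ubnP #|[set u | y u != 0]|.
elim: N y => // N IH y; rewrite ltnS => cN yx By.
have y0 u : 0 <= y u by have /andP[] := yx u.
have [[u0 yu0]|no] := pselect (exists u, 0 < y u); last first.
  have yz u : y u = 0.
    by apply/eqP; apply: contra_notT no => yu; exists u; rewrite lt_def yu y0.
  rewrite big1 // (_ : [set u | _] = finset.set0) ?cards0 ?mul0r //.
  by apply/setP => u; rewrite !inE yz eqxx.
have [r [Br rp rsupp rC]] := ray y y0 (ex_intro _ u0 yu0) By.
have C0 : 0 <= C by apply: le_trans rC; apply: sumr_ge0.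
have [u1 ru1] := rp.
have [u2 r2 min2] : exists2 u2, (0 < r u2)%N &
    forall u, (0 < r u)%N -> y u2 / (r u2)%:R <= y u / (r u)%:R.
  by case: (@arg_minP _ _ _ u1 (fun u => 0 < r u)%N (fun u => y u / (r u)%:R) ru1)
    => u2 ? H; exists u2.
pose l := y u2 / (r u2)%:R.
have ly u : l * (r u)%:R <= y u.
  case: (posnP (r u)) => [->|ru]; first by rewrite mulr0.
  by rewrite -ler_pdivlMr ?ltr0n // min2.
have yu2 : y u2 != 0 by apply: contraTneq r2 => /rsupp ->.
have cp : (0 < #|[set u | (y u != 0)%R]|)%N by apply/card_gt0P; exists u2; rewrite inE.
have [l1|l1] := leP 1 l.
  have rx : r =1 x.
    apply: irr => // u; rewrite -(ler_nat R).
    have /andP[_] := yx u; apply: le_trans; apply: le_trans (ly u).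
    by rewrite ler_peMl.
  apply: (@le_trans _ _ C); last by rewrite ler_peMl // ler1n.
  apply: le_trans rC; apply: ler_sum => u _; rewrite rx.
  by have /andP[] := yx u.
have l0 : 0 <= l by rewrite divr_ge0.
pose y' u := y u - l * (r u)%:R.
have y'0 u : 0 <= y' u by rewrite subr_ge0.
have supp' : [set u | y' u != 0] \subset [set u | y u != 0] :\ u2.
  apply/subsetP => u; rewrite !inE => y'u; apply/andP; split.
    by apply: contra_neq y'u => ->; rewrite /y' /l divfK ?subrr // pnatr_eq0 -lt0n.
  by apply: contra_neq y'u => yu; rewrite /y' yu (rsupp _ yu) mulr0 subrr.
have c' := subset_leq_card supp'.
have cD := cardsD1 u2 [set u | y u != 0]; rewrite inE yu2 /= in cD.
have cl : (#|[set u | (y' u != 0)%R]| < #|[set u | (y u != 0)%R]|)%N.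
  by rewrite cD add1n ltnS.
have := IH y'.
have -> : \sum_u y u = \sum_u y' u + l * \sum_u (r u)%:R.
  by rewrite mulr_sumr -big_split /=; apply: eq_bigr => u _; rewrite /y' subrK.
move=> H; apply: (@le_trans _ _ (#|[set u | y' u != 0]|%:R * C + C)).
  apply: lerD.
    apply: H; first exact: leq_trans cl cN.
      move=> u; rewrite y'0 /=; have /andP[_] := yx u; apply: le_trans.
      by rewrite /y' gerBl mulr_ge0.
    exact: balanced_lin.
  apply: le_trans rC; rewrite ger_pMl ?(ltW l1) //.
  by apply: lt_le_trans (_ : 0 < (r u1)%:R) _; rewrite ?ltr0n // (bigD1 u1) //= lerDl sumr_ge0.
by rewrite -[X in _ + X]mul1r -mulrDl ler_wpM2r // natr1 ler_nat.
Qed.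

(** * Row types up to constants and the upper bound *)

Lemma sum_fibres (I T : finType) (t : I -> T) (E : {set I}) (F : T -> nat) :
  (\sum_(i in E) F (t i) = \sum_x #|E :&: [set i | t i == x]| * F x)%N.
Proof.
rewrite (partition_big t predT) //=; apply: eq_bigr => x _.
rewrite (eq_bigr (fun=> F x)) => [|i /andP[_ /eqP <-] //].
by rewrite sum_nat_const; congr (_ * _)%N; apply: eq_card => i; rewrite !inE.
Qed.

Lemma card_fibres (I T : finType) (t : I -> T) (E : {set I}) :
  (#|E| = \sum_x #|E :&: [set i | t i == x]|)%N.
Proof.
rewrite -sum1_card (sum_fibres t E (fun=> 1%N)).
by apply: eq_bigr => x _; rewrite muln1.
Qed.

(** Turns prescribed multiplicities into the rows of a matrix. *)
Lemma labelling_with_fibres (T : finType) (c : T -> nat) :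
  exists m (t : 'I_m -> T), forall x, #|[set i | t i == x]| = c x.
Proof.
pose S : finType := {x : T & 'I_(c x)}.
exists #|S|, (fun i => tag (enum_val i : S)) => x.
pose g (q : 'I_(c x)) : 'I_#|S| := enum_rank (Tagged (fun x => 'I_(c x)) q : S).
have gI : injective g.
  by move=> q q' /enum_rank_inj /eqP; rewrite eq_Tagged => /eqP.
rewrite -[RHS]card_ord -[RHS]cardsT -(card_imset _ gI).
apply: eq_card => i; rewrite inE; apply/eqP/imsetP => [|[q _ ->]]; last by rewrite /g enum_rankK.
case E : (enum_val i) => [y q] /= yx; subst y.
by exists q => //; apply: enum_val_inj; rewrite /g enum_rankK E.
Qed.

Lemma exists_subset_card (T : finType) (S : {set T}) q : (q <= #|S|)%N ->
  exists2 E : {set T}, E \subset S & #|E| = q.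
Proof.
move=> qS; exists [set x in take q (enum S)].
  by apply/subsetP => x; rewrite inE => /mem_take; rewrite mem_enum.
rewrite cardsE (card_uniqP _) ?take_uniq ?enum_uniq // size_takel //.
by rewrite -cardE.
Qed.

Definition min_zero n k : {set {ffun 'I_n -> 'I_k.+1}} :=
  [set u : {ffun 'I_n -> 'I_k.+1} | [exists j, u j == ord0]].

(** Counted by the complement: functions without the value 0. *)
Lemma card_min_zero n k : (#|min_zero n k| = k.+1 ^ n - k ^ n)%N.
Proof.
have <- : #|~: min_zero n k| = (k ^ n)%N.
  have -> : #|~: min_zero n k| = #|(ffun_on (predC1 ord0) : {pred {ffun 'I_n -> 'I_k.+1}})|.
    apply: eq_card => u; rewrite !inE negb_exists.
    by apply/forallP/ffun_onP => H j; have := H j; rewrite !inE.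
  by rewrite card_ffun_on cardC1 !card_ord.
have := cardsC (min_zero n k); rewrite card_ffun !card_ord => <-.
by rewrite addnK.
Qed.

(** Adding a row and its antipode gives a constant row; subtracting from the
    maximum, rather than from k, keeps the minimum 0. *)
Definition antipode n k (u : {ffun 'I_n -> 'I_k.+1}) : {ffun 'I_n -> 'I_k.+1} :=
  [ffun j => inord (\max_i u i - u j)].

Lemma antipodeE n k (u : {ffun 'I_n -> 'I_k.+1}) j :
  (antipode u j = \max_i u i - u j :> nat)%N.
Proof.
rewrite ffunE inordK // ltnS (leq_trans (leq_subr _ _)) //.
by apply/bigmax_leqP => i _; rewrite -ltnS.
Qed.

Lemma antipode_sum n k (u : {ffun 'I_n -> 'I_k.+1}) j :
  (u j + antipode u j = \max_i u i)%N.
Proof. by rewrite antipodeE subnKC // (leq_bigmax (F := fun i => nat_of_ord (u i))). Qed.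

Lemma antipode_min_zero n k (u : {ffun 'I_n.+1 -> 'I_k.+1}) :
  antipode u \in min_zero n.+1 k.
Proof.
have [i ui] : exists i, (\max_i u i = u i)%N.
  have I0 : (0 < #|'I_n.+1|)%N by rewrite card_ord.
  by have [i ->] := bigop.eq_bigmax (fun i => nat_of_ord (u i)) I0; exists i.
rewrite inE; apply/existsP; exists i; apply/eqP/val_inj.
by rewrite /= antipodeE ui subnn.
Qed.

Lemma antipodeK n k : {in min_zero n.+1 k, cancel (@antipode n.+1 k) (@antipode n.+1 k)}.
Proof.
move=> u; rewrite inE => /existsP[i0 /eqP ui0]; apply/ffunP => j; apply/val_inj.
rewrite /= antipodeE.
suff -> : (\max_i antipode u i = \max_i u i)%N by rewrite -(antipode_sum u j) addnK.
apply/eqP; rewrite eqn_leq; apply/andP; split.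
  by apply/bigmax_leqP => i _; rewrite antipodeE leq_subr.
rewrite -(antipode_sum u i0) ui0 add0n.
by rewrite (leq_bigmax (F := fun i => nat_of_ord (antipode u i))).
Qed.

Lemma row_type n k (a : 'I_n.+1 -> nat) : (forall j, a j <= k)%N ->
  exists uc : {ffun 'I_n.+1 -> 'I_k.+1} * nat,
    uc.1 \in min_zero n.+1 k /\ forall j, a j = (uc.1 j + uc.2)%N.
Proof.
move=> ak; have [j0 minj] : exists j0, forall j, (a j0 <= a j)%N.
  by case: (@arg_minnP _ ord0 xpredT a isT) => j0 _ H; exists j0 => j; apply: H.
exists ([ffun j => inord (a j - a j0)], a j0); split.
  rewrite inE; apply/existsP; exists j0; rewrite ffunE subnn.
  by apply/eqP/val_inj; rewrite /= inordK.
move=> j; rewrite ffunE inordK ?subnK //.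
by rewrite ltnS (leq_trans (leq_subr _ _)).
Qed.

(** With x the number of rows of each type, irreducibility of the matrix is
    minimality of x among level weights, so [irreducible_weight_le] bounds the
    number of rows by C times the number of types that occur; the antipodes of
    these types are as many further types, none of which occurs.  The hypothesis
    on m makes a set of one or two rows proper. *)
Lemma irreducible_size_le (R : rcfType) m n k (A : 'M[nat]_(m, n.+1)) :
  (0 < k)%N -> (2 < m)%N -> is_kmatrix k A -> is_level A -> ~ is_reducible A ->
  m%:R * 2 <= (k.+1 ^ n.+1 - k ^ n.+1)%N%:R * ((k%:R / 2) ^+ n * Num.sqrt (n.+2%:R ^+ n.+2)) :> R.
Proof.
move=> k0 m3 Ak Al irr.
have irrE (E : {set 'I_m}) : (0 < #|E|)%N ->
    (forall j1 j2, (\sum_(i in E) A i j1 = \sum_(i in E) A i j2)%N) -> (m <= #|E|)%N.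
  move=> E0 lE; rewrite leqNgt; apply/negP => Em; apply: irr; apply/reducibleP.
  by exists E; rewrite E0 Em.
pose U : finType := {ffun 'I_n.+1 -> 'I_k.+1}.
have [tc tcP] := fin_all_exists (fun i => row_type (Ak i)).
pose t i : U := (tc i).1; pose c i := (tc i).2.
have tmin i : t i \in min_zero n.+1 k by case: (tcP i).
have AE i j : A i j = (t i j + c i)%N by case: (tcP i).
pose v (u : U) (j : 'I_n.+1) := nat_of_ord (u j).
pose fib u := [set i | t i == u].
have sumE (E : {set 'I_m}) j : (\sum_(i in E) A i j =
    \sum_u #|E :&: fib u| * v u j + \sum_(i in E) c i)%N.
  under eq_bigr do rewrite AE.
  by rewrite big_split /= -(sum_fibres t E (v^~ j)).
pose x u := #|fib u|.
have sumx : (\sum_u x u)%N = m.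
  rewrite -[RHS]card_ord -cardsT (card_fibres t).
  by apply: eq_bigr => u _; rewrite setTI.
have natE (r : U -> nat) j : \sum_u (r u)%:R * (v u j)%:R = (\sum_u r u * v u j)%N%:R :> R.
  by rewrite natr_sum; apply: eq_bigr => u _; rewrite natrM.
have Bx : balanced v (fun u => (x u)%:R : R).
  move=> j1 j2; rewrite !natE; congr (_%:R); apply/eqP.
  rewrite -(eqn_add2r (\sum_(i in [set: 'I_m]) c i)).
  have H j : (\sum_u x u * v u j + \sum_(i in [set: 'I_m]) c i = \sum_i A i j)%N.
    rewrite -big_setT_ord sumE.
    by congr (_ + _)%N; apply: eq_bigr => u _; rewrite setTI.
  by rewrite !H (Al j1 j2).
have irr_x (r : U -> nat) : balanced v (fun u => (r u)%:R : R) ->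
    (exists u, 0 < r u)%N -> (forall u, r u <= x u)%N -> r =1 x.
  move=> Br [u0 ru0] rx.
  have [Es EsP EsC] := fin_all_exists2 (fun u => exists_subset_card (rx u)).
  pose E := [set i | i \in Es (t i)].
  have EI u : E :&: fib u = Es u.
    apply/setP => i; rewrite !inE; apply/andP/idP => [[iE /eqP <-] //|iE].
    by have := subsetP (EsP u) _ iE; rewrite inE => /eqP tu; rewrite tu.
  have cEu u : #|E :&: fib u| = r u by rewrite EI EsC.
  have cE : #|E| = (\sum_u r u)%N.
    by rewrite (card_fibres t); apply: eq_bigr => u _; apply: cEu.
  have mE : (m <= #|E|)%N.
    apply: irrE; first by rewrite cE (bigD1 u0) //= addn_gt0 ru0.
    move=> j1 j2; rewrite !sumE; congr (_ + _)%N.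
    have := Br j1 j2; rewrite !natE => /eqP; rewrite eqr_nat => /eqP.
    by under eq_bigr do rewrite -cEu; under [RHS]eq_bigr do rewrite -cEu.
  move=> u; apply/eqP; rewrite eqn_leq rx leqNgt; apply/negP => ru.
  move: mE; rewrite cE -sumx leqNgt => /negP; apply.
  by rewrite (bigD1 u) //= [X in (_ < X)%N](bigD1 u) //= -addSn leq_add // leq_sum.
pose C : R := (k%:R / 2) ^+ n * Num.sqrt (n.+2%:R ^+ n.+2).
have C0 : 0 <= C by rewrite mulr_ge0 ?sqrtr_ge0 // exprn_ge0 // divr_ge0.
have rays (y : U -> R) : (forall u, 0 <= y u) -> (exists u, 0 < y u) -> balanced v y ->
     exists r : U -> nat, [/\ balanced v (fun u => (r u)%:R : R), exists u, (0 < r u)%N,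
       forall u, y u = 0 -> r u = 0%N & \sum_u (r u)%:R <= C].
  move=> y0 yp By.
  have [|r [Br rp rs rb]] := small_ray k0 _ y0 yp By; first by move=> u j; rewrite /v -ltnS ltn_ord.
  exists r; split => //.
  rewrite -(@ler_pXn2r _ 2) ?nnegrE //; last exact: sumr_ge0.
  by rewrite /C exprMn sqr_sqrtr // exprn_ge0.
have main := irreducible_weight_le irr_x rays (fun u => _) Bx.
pose S := [set u | ((x u)%:R : R) != 0].
have SE u : u \in S -> exists i, t i = u.
  rewrite inE pnatr_eq0 -lt0n => /card_gt0P[i]; rewrite inE => /eqP.
  by exists i.
have Sap u : u \in S -> antipode u \notin S.
  move=> /SE [i ti]; apply/negP => /SE [i' ti'].
  have : (m <= #|[set i; i']|)%N.
    apply: irrE; first by apply/card_gt0P; exists i; rewrite !inE eqxx.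
    move=> j1 j2; have := antipode_sum u j1; have := antipode_sum u j2.
    have [ii|ii] := eqVneq i i'.
      rewrite -ti' -ii setUid !big_set1 !AE ti;
      move: (nat_of_ord (u j1)) (nat_of_ord (u j2)) => a b; lia.
    move=> H2 H1; rewrite !big_setU1 ?inE //= !big_set1 !AE ti ti'.
    by rewrite addnACA H1 [RHS]addnACA H2.
  by rewrite leqNgt (leq_trans _ m3) // cards2; case: eqP.
have Smin : S \subset min_zero n.+1 k by apply/subsetP => u /SE [i <-].
(* S and its set of antipodes are disjoint sets of types with minimum 0. *)
have cS : (#|S| + #|S| <= k.+1 ^ n.+1 - k ^ n.+1)%N.
  rewrite -card_min_zero -{2}(card_in_imset (f := @antipode n.+1 k) (D := mem S)).
    rewrite -cardsUI (_ : S :&: _ = set0) ?cards0 ?addn0.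
      apply: subset_leq_card; rewrite subUset Smin /=.
      by apply/subsetP => _ /imsetP[u _ ->]; apply: antipode_min_zero.
    apply/setP => u; rewrite !inE; apply/negP => /andP[uS /imsetP[w wS uw]].
    by move: (Sap w wS); rewrite -uw inE uS.
  by move=> u w /(subsetP Smin) uS /(subsetP Smin) wS /(congr1 (@antipode _ _)); rewrite !antipodeK.
have mS : m%:R <= #|S|%:R * C.
  have := main _; rewrite -natr_sum sumx; apply.
  by move=> u; rewrite lexx ler0n.
apply: (@le_trans _ _ ((#|S| + #|S|)%N%:R * C)); last by rewrite ler_wpM2r // ler_nat.
by rewrite natrD; lra.
Qed.

Lemma upper_bound (R : realType) n k : (3 <= n)%N -> (0 < k)%N ->
  exists l : nat, is_ell n k l /\
       l%:R <= (if (n == 3)%N then (2 * k%:R) ^+ 3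
                else k%:R ^+ n.-1 * 2 ^- n
                     * n.+1%:R `^ (n.+1%:R / 2)
                     * (k.+1%:R ^+ n - k%:R ^+ n + 1) : R).
Proof.
move=> n3 k0; case: eqP => [->|_].
  have [l le lb] := ell_exists (reducible_above3 k0); exists l; split => //.
  by rewrite -natrM -natrX ler_nat.
case: n n3 => // n n3 /=; set B : R := _ * _.
pose D := (k.+1 ^ n.+1 - k ^ n.+1)%N.
have kD : (k ^ n.+1 < k.+1 ^ n.+1)%N by rewrite ltn_exp2r.
have DE : k.+1%:R ^+ n.+1 - k%:R ^+ n.+1 = D%:R :> R by rewrite natrB 1?ltnW // !natrX.
pose S : R := Num.sqrt (n.+2%:R ^+ n.+2).
have SE : n.+2%:R `^ (n.+2%:R / 2) = S.
  by rewrite powRrM powR_mulrn // powR12_sqrt // exprn_ge0.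
have BE : B = k%:R ^+ n * 2 ^- n.+1 * S * (D%:R + 1) by rewrite /B SE DE.
have S2 : 2 ^+ n.+1 <= S.
  rewrite -(@ler_pXn2r _ 2) ?nnegrE ?sqrtr_ge0 ?exprn_ge0 // sqr_sqrtr ?exprn_ge0 //.
  rewrite -exprM mulnC exprM.
  apply: (@le_trans _ _ (n.+2%:R ^+ n.+1)).
    rewrite ler_pXn2r ?nnegrE ?exprn_ge0 // -natrX ler_nat; lia.
  by rewrite ler_weXn2l // ler1n.
(* Needed to exclude matrices with at most two rows, which have no proper pair of rows. *)
have B2 : 2 <= B.
  have k1 : 1 <= k%:R ^+ n :> R by rewrite exprn_ege1 // ler1n.
  have D1 : 2 <= D%:R + 1 :> R.
    by rewrite natr1 ler_nat ltnS subn_gt0.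
  have S1 : 1 <= 2 ^- n.+1 * S by rewrite mulrC ler_pdivlMr ?mul1r ?exprn_gt0.
  rewrite BE; apply: le_trans D1 _; rewrite ler_peMl ?addr_ge0 //.
  by rewrite -mulrA mulr_ege1.
have [l le lb] : exists2 l, is_ell n.+1 k l & (l <= Num.truncn B)%N.
  apply: ell_exists => m mb A Ak Al; apply: contrapT => irr.
  have Bm : B < m%:R by rewrite -truncn_lt_nat // (le_trans _ B2).
  have m3 : (2 < m)%N by rewrite -(ltr_nat R); apply: le_lt_trans B2 Bm.
  have := @irreducible_size_le R m n k A k0 m3 Ak Al irr; rewrite -/S -/D => H.
  have : m%:R <= B.
    rewrite BE -(@ler_pM2r _ 2) //; apply: le_trans H _.
    have -> : k%:R ^+ n * 2 ^- n.+1 * S * (D%:R + 1) * 2 =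
        (D%:R + 1) * ((k%:R / 2) ^+ n * S) :> R.
      by rewrite exprS expr_div_n; field; rewrite expf_neq0.
    rewrite ler_wpM2r ?lerDl // mulr_ge0 ?sqrtr_ge0 // exprn_ge0 // divr_ge0 //.
  by rewrite leNgt Bm.
exists l; split => //; apply: le_trans (_ : (Num.truncn B)%:R <= B).
  by rewrite ler_nat.
by rewrite truncn_le // (le_trans _ B2).
Qed.

(** * Exponentially many rows and the lower bound *)

(** Kinds of rows of the doubling matrix: [None] is a row z used once,
    [Some (i, false)] is a row x_i used 2^i times, and [Some (i, true)] is a row
    y_i used 2^N - 2^i times, which completes x_i to the column sum 2^N. *)
Definition doubling_mult N (t : option ('I_N * bool)) : nat :=
  (if t is Some (i, b) then if b then 2 ^ N - 2 ^ i else 2 ^ i else 1)%N.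

(** Column [inl i] contains x_i and y_i, so that in a level weight y_i = d - x_i;
    column [inr j] contains z, the x_i with i < j, and y_j when j < N, so that
    x_j = z + x_0 + .. + x_(j-1) for j < N, and d = z + x_0 + .. + x_(N-1). *)
Definition doubling_inc N (t : option ('I_N * bool)) (c : 'I_N + 'I_N.+1) : bool :=
  match t, c with
  | None, inl _ => false
  | None, inr _ => true
  | Some (i, _), inl i' => i == i'
  | Some (i, b), inr j => if b then i == j :> nat else (i < j)%N
  end.

Lemma sum_option_pair N (F : option ('I_N * bool) -> nat) :
  (\sum_t F t = F None + \sum_i (F (Some (i, false)) + F (Some (i, true))))%N.
Proof.
rewrite (bigD1 None) //=; congr (_ + _)%N.
rewrite (reindex_omap Some id) => [|[]] //=.
rewrite (eq_bigl predT) => [|t]; last by rewrite eqxx.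
rewrite (eq_bigr (fun p => F (Some (p.1, p.2)))) => [|[]//].
rewrite -(pair_bigA _ (fun i b => F (Some (i, b)))) /=.
by apply: eq_bigr => i _; rewrite big_bool addnC.
Qed.

Lemma sum_pow2 j : (\sum_(i < j) 2 ^ i).+1 = (2 ^ j)%N.
Proof. by elim: j => [|j IH]; rewrite ?big_ord0 // big_ord_recr /= -addSn IH addnn -mul2n expnS. Qed.

Lemma doubling_col_inl N (s : option ('I_N * bool) -> nat) i :
  (\sum_t s t * doubling_inc t (inl i) = s (Some (i, false)) + s (Some (i, true)))%N.
Proof.
rewrite sum_option_pair /= muln0 add0n (bigD1 i) //= eqxx !muln1 big1 ?addn0 // => i' /negPf.
by move=> ->; rewrite !muln0.
Qed.

Lemma doubling_col_inr N (s : option ('I_N * bool) -> nat) (j : 'I_N.+1) :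
  (\sum_t s t * doubling_inc t (inr j) = s None + \sum_(i < N | i < j) s (Some (i, false)) +
     \sum_(i < N | i == j :> nat) s (Some (i, true)))%N.
Proof.
rewrite sum_option_pair /= muln1 big_split addnA /= [in RHS]big_mkcond [X in (_ = _ + X)%N]big_mkcond /=.
by congr (_ + _ + _)%N; apply: eq_bigr => i _; case: ifP; rewrite ?muln1 ?muln0.
Qed.

Lemma doubling_column_sum N c : (\sum_t doubling_mult t * @doubling_inc N t c = 2 ^ N)%N.
Proof.
case: c => [i|j]; first by rewrite doubling_col_inl /= subnKC // leq_exp2l // ltnW.
rewrite doubling_col_inr /= add1n.
have -> : (\sum_(i < N | i < j) 2 ^ i = \sum_(i < j) 2 ^ i)%N.
  by rewrite (big_ord_widen N (fun i => 2 ^ i)%N) // -ltnS.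
rewrite sum_pow2; case: (ltnP j N) => jN.
  rewrite (big_pred1 (Ordinal jN)) => [|i]; last by [].
  by rewrite /= subnKC // leq_exp2l // ltnW.
have -> : j = N :> nat by apply/eqP; rewrite eqn_leq jN -ltnS ltn_ord.
by rewrite big_pred0 ?addn0 // => i; rewrite ltn_eqF.
Qed.

(** The level equations have a one-dimensional space of solutions, parametrised by
    the multiplicity of z: they determine x_j by the doubling recurrence, then
    d, then y_i. *)
Lemma level_doubling_mult N (s : option ('I_N * bool) -> nat) :
  (forall c1 c2, \sum_t s t * doubling_inc t c1 = \sum_t s t * @doubling_inc N t c2)%N ->
  forall t, s t = (doubling_mult t * s None)%N.
Proof.
move=> ls.
(* Columns inl i and inr i have the same sum, and both contain y_i. *)
have x_rec (i : 'I_N) : s (Some (i, false)) =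
    (s None + \sum_(i' < N | i' < i) s (Some (i', false)))%N.
  have := ls (inl i) (inr (widen_ord (leqnSn N) i)).
  rewrite doubling_col_inl doubling_col_inr /= [X in _ = (_ + X)%N -> _](big_pred1 i); last first.
    by move=> i'; rewrite /= -val_eqE.
  by move/eqP; rewrite eqn_add2r => /eqP.
have xE (i : 'I_N) : s (Some (i, false)) = (2 ^ i * s None)%N.
  have [q] := ubnP (i : nat); elim: q i => // q IH i iq.
  rewrite x_rec (eq_bigr (fun i' : 'I_N => 2 ^ i' * s None))%N; last first.
    by move=> i' i'i; apply: IH; lia.
  rewrite -big_distrl /= -(big_ord_widen N (fun i => 2 ^ i)%N) 1?ltnW //.
  by rewrite -(sum_pow2 i) mulSn.
(* The last column contains none of the y_i. *)
have dE c : (\sum_t s t * doubling_inc t c = 2 ^ N * s None)%N.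
  rewrite (ls c (inr ord_max)) doubling_col_inr /= [X in (_ + X)%N]big_pred0 ?addn0; last first.
    by move=> i; rewrite ltn_eqF.
  rewrite (eq_bigl predT) => [|i]; last by rewrite ltn_ord.
  by under eq_bigr do rewrite xE; rewrite -big_distrl /= -(sum_pow2 N) mulSn.
case=> [[i []]|]; rewrite ?mul1n //=.
by have := dE (inl i); rewrite doubling_col_inl xE mulnBl => <-; rewrite addKn.
Qed.

(** A level set of rows uses each kind of row s(z) times its total multiplicity,
    and s(z) is 0 or 1 as there is a single row z; so the set is empty or full.
    There are at least as many rows as the column sum 2^N. *)
Lemma large_irreducible N : exists m (A : 'M[nat]_(m, N + N.+1)),
  [/\ (2 ^ N <= m)%N, is_kmatrix 1 A, is_level A & ~ is_reducible A].
Proof.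
have [m [t tE]] := labelling_with_fibres (@doubling_mult N).
pose A : 'M[nat]_(m, N + N.+1) := \matrix_(i, j) nat_of_bool (doubling_inc (t i) (split j)).
have sumE (E : {set 'I_m}) j : (\sum_(i in E) A i j =
    \sum_x #|E :&: [set i | t i == x]| * doubling_inc x (split j))%N.
  by rewrite -(sum_fibres t E (fun x => doubling_inc x (split j) : nat)); apply: eq_bigr => i _; rewrite mxE.
have mE : m = (\sum_x @doubling_mult N x)%N.
  rewrite -[LHS]card_ord -cardsT (card_fibres t).
  by apply: eq_bigr => x _; rewrite setTI tE.
exists m, A; split.
- rewrite mE -(@doubling_column_sum N (inr ord_max)); apply: leq_sum => x _.
  by rewrite -[X in (_ <= X)%N]muln1 leq_mul // leq_b1.
- by move=> i j; rewrite mxE leq_b1.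
- move=> j1 j2.
  have H j : (\sum_i A i j = 2 ^ N)%N.
    rewrite -(@doubling_column_sum N (split j)) -big_setT_ord sumE.
    by apply: eq_bigr => x _; rewrite setTI tE.
  by rewrite !H.
move/reducibleP => [E [/andP[E0 Em] lE]].
pose s x := #|E :&: [set i | t i == x]|.
have sE : forall x, s x = (doubling_mult x * s None)%N.
  apply: level_doubling_mult => c1 c2.
  by have := lE (unsplit c1) (unsplit c2); rewrite !sumE !unsplitK.
have : (#|E| = m * s None)%N.
  by rewrite (card_fibres t) [X in (X * _)%N]mE big_distrl; apply: eq_bigr => x _; rewrite -/(s x) sE.
have : (s None <= @doubling_mult N None)%N by rewrite -tE subset_leq_card ?subsetIr.
by case: (s None) => [|[|]] // _ cE; move: E0 Em; rewrite cE ?muln0 // muln1 ltnn.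
Qed.

Lemma poly_growth (R : realFieldType) (L x : R) : L <= x -> 41 <= x ->
  x ^+ 2 * (L *+ 2) < ((x ^+ 2 - 1) / 2 / 2) ^+ 2.
Proof.
move=> Lx x41.
have x0 : 0 < x by lra.
have : x ^+ 2 * (L *+ 2) <= x ^+ 2 * (2 * x).
  by rewrite ler_wpM2l ?sqr_ge0 // -mulr_natl; lra.
move=> /le_lt_trans; apply.
have x3 : 41 * x ^+ 3 <= x ^+ 4 by rewrite [leRHS]exprS ler_wpM2r // exprn_ge0 // ltW.
have x2 : 41 * x ^+ 2 <= x ^+ 3 by rewrite [leRHS]exprS ler_wpM2r // exprn_ge0 // ltW.
have -> : ((x ^+ 2 - 1) / 2 / 2) ^+ 2 = (x ^+ 4 - 2 * x ^+ 2 + 1) / 16 by field.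
have -> : x ^+ 2 * (2 * x) = 2 * x ^+ 3 by ring.
have : 0 < x ^+ 3 by rewrite exprn_gt0.
by lra.
Qed.

(** For n = s^2 the bound ln n = 2 ln s <= 2 s makes the left side at most
    sqrt (2 s^3), against (s^2 - 1) / 4 on the right. *)
Lemma sqrt_log_growth (R : realType) (s N : nat) : (41 <= s)%N -> (s ^ 2 = N + N.+1)%N ->
  Num.sqrt ((N + N.+1)%:R * ln (N + N.+1)%:R) < N%:R / 2 :> R.
Proof.
move=> s41 sN; rewrite -sN.
have s0 : 0 < s%:R :> R by rewrite ltr0n; lia.
have lns : ln s%:R <= s%:R :> R.
  by apply: ltW; apply: ln_sublinear.
have NE : N%:R = (s%:R ^+ 2 - 1) / 2 :> R.
  by rewrite -natrX sN addnS -addn1 !natrD; field.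
have s41R : 41 <= s%:R :> R by rewrite ler_nat.
rewrite NE natrX lnXn // -[ltRHS]ger0_norm; last by nra.
rewrite -sqrtr_sqr ltr_sqrt; last by apply: exprn_gt0; nra.
exact: poly_growth.
Qed.

(** Because exp (-1/2) >= 1 - 1/2. *)
Lemma expR_half_le (R : realType) N : expR (N%:R / 2) <= 2 ^+ N :> R.
Proof.
rewrite expRM_natl; apply: lerXn2r; rewrite ?nnegrE ?expR_ge0 //.
have := @expR_ge1Dx R (- 2^-1); rewrite expRN.
have e0 := @expR_gt0 R 2^-1; move=> h.
rewrite -[leRHS]invrK -[leLHS]invrK lef_pV2 ?posrE ?invr_gt0 //; lra.
Qed.

(** The values of n are odd squares: n = s^2 = 2N + 1 with s odd, which makes both
    the number of columns of the doubling matrix and the logarithm of n easy to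
    control.  A finite set of n would be bounded by some a, and s = 2a + 41 gives
    an n beyond it. *)
Lemma lower_bound (R : realType) (eps : R) : 0 < eps ->
  infinite_set [set n : nat | (3 <= n)%N /\
    exists l : nat, is_ell n 1 l /\
      expR ((1 - eps) * Num.sqrt (n%:R * ln n%:R)) < l%:R]%classic.
Proof.
move=> eps0 /finite_seqP [s sP].
pose a := \max_(x <- s) x.
(* Chosen so that 2N + 1 is the square of 2a + 41. *)
pose N := (2 * a ^ 2 + 82 * a + 840)%N.
suff : (N + N.+1)%N \in s.
  by move=> /(leq_bigmax_seq (P := xpredT) (F := id)) /(_ isT); rewrite -/a /N; lia.
have : [set` s]%classic (N + N.+1)%N; last by [].
rewrite -sP; have n3 : (3 <= N + N.+1)%N by rewrite /N; lia.
split => //.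
have [l [le _]] := upper_bound R n3 (isT : (0 < 1)%N).
exists l; split => //.
have [m [A [mN Ak Al irr]]] := large_irreducible N.
have ml : (m <= l)%N by rewrite leqNgt; apply/negP => lm; apply/irr/(proj1 le).
apply: lt_le_trans (_ : (2 ^ N)%N%:R <= l%:R); last by rewrite ler_nat (leq_trans mN).
rewrite natrX; apply: lt_le_trans (expR_half_le R N).
rewrite ltr_expR; apply: le_lt_trans (_ : _ <= Num.sqrt ((N + N.+1)%:R * ln (N + N.+1)%:R)) _.
  by rewrite ler_piMl ?sqrtr_ge0 //; lra.
apply: (@sqrt_log_growth R (2 * a + 41)); first lia.
by rewrite /N; nia.
Qed.

Local Open Scope classical_set_scope.
Local Open Scope ring_scope.

Theorem theorem2 (R : realType) :
  (forall eps : R, 0 < eps ->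
     infinite_set [set n : nat | (3 <= n)%N /\
       exists l : nat, is_ell n 1 l /\
         expR ((1 - eps) * Num.sqrt (n%:R * ln n%:R)) < l%:R])
  /\
  (forall n k : nat, (3 <= n)%N -> (0 < k)%N ->
     exists l : nat, is_ell n k l /\
       l%:R <= (if (n == 3)%N then (2 * k%:R) ^+ 3
                else k%:R ^+ n.-1 * 2 ^- n
                     * n.+1%:R `^ (n.+1%:R / 2)
                     * (k.+1%:R ^+ n - k%:R ^+ n + 1) : R)).
Proof.
split=> [eps eps0|n k n3 k0]; first exact: lower_bound.
exact: upper_bound.
Qed.
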